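(* Let $z>2$ be a real number and let $n\in\mathbb{N}$. Then the multiplicative semigroup $M_n(\mathbb{T}_{[1,z]})$ of $n\times n$ matrices over $\mathbb{T}_{[1,z]}$ is strongly permutable if and only if $n<3$.
   Context: $\mathbb{N}$ denotes the natural numbers excluding $0$. For real $z>1$, $\mathbb{T}_{[1,z]}$ is the semiring with underlying set $[1,z]\cup\{0,-\infty\}$ ($[1,z]$ the real interval), with maximum as addition and truncated addition $(a,b)\mapsto\min(a+b,z)$ as multiplication ($+$ classical, $-\infty+a=-\infty$). Matrix multiplication is induced from these operations in the usual way. A semigroup $T$ is strongly permutable (or permutable) if there exists $k\geq 2$ such that for all $s_1,\dots,s_k\in T$ there is a non-identity permutation $\sigma$ of $\{1,\dots,k\}$ with $s_{\sigma(1)}\cdots s_{\sigma(k)}=s_1\cdots s_k$. *)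

(* Defs.v *)
From HB Require Import structures.
From mathcomp Require Import all_boot all_order all_algebra all_fingroup.
From mathcomp Require Import reals constructive_ereal.

Set Implicit Arguments.
Unset Strict Implicit.
Unset Printing Implicit Defensive.

Import Order.TTheory GRing.Theory Num.Theory.
Local Open Scope ring_scope.

(* No unit is assumed: the bigop is a right fold that starts from the last
   factor, so it computes s 0 * (s 1 * (... * s k)). *)
Definition sgprod (T : semigroupType) (k : nat) (s : 'I_k.+1 -> T) : T :=
  \big[*%g/s ord_max]_(i < k) s (widen_ord (leqnSn k) i).

(* Words of length k.+2, i.e., of any length at least 2. *)
Definition strongly_permutable (T : semigroupType) : Prop :=
  exists k : nat, forall s : 'I_k.+2 -> T,
    exists2 sigma : 'S_k.+2, sigma <> 1%g & sgprod (s \o sigma) = sgprod s.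

Definition mult_semigroup (A : pzSemiRingType) : Type := A.

HB.instance Definition _ (A : pzSemiRingType) := Choice.on (mult_semigroup A).
HB.instance Definition _ (A : pzSemiRingType) :=
  isSemigroup.Build (mult_semigroup A) (@mulrA A).

Definition in_trunc (R : realType) (z : R) : pred (\bar R) :=
  fun x => [|| x == -oo, x == 0 | 1 <= x <= z%:E]%E.

(* The proof of 1 < z is a parameter of the type, so that the semiring laws,
   which need a bound on z, can be attached to it as canonical instances. *)
Record trunc_trop (R : realType) (z : R) (z_gt1 : 1 < z) := TruncTrop {
  trunc_val :> \bar R;
  trunc_valP : in_trunc z trunc_val
}.

HB.instance Definition _ (R : realType) (z : R) (z_gt1 : 1 < z) :=
  [isSub for @trunc_val R z z_gt1].
HB.instance Definition _ (R : realType) (z : R) (z_gt1 : 1 < z) :=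
  [Choice of trunc_trop z_gt1 by <:].

Section TruncatedSemiring.
Context (R : realType) (z : R) (z_gt1 : 1 < z).
Local Notation T := (trunc_trop z_gt1).
Implicit Types a b c : T.
Local Open Scope ereal_scope.

Lemma in_trunc_ninfty : in_trunc z -oo.
Proof. by rewrite /in_trunc eqxx. Qed.

Lemma in_trunc0 : in_trunc z 0.
Proof. by rewrite /in_trunc eqxx orbT. Qed.

Lemma in_trunc_max a b : in_trunc z (maxe (trunc_val a) (trunc_val b)).
Proof. by rewrite /maxe; case: ifP => _; apply: trunc_valP. Qed.

Lemma in_truncP (x : \bar R) :
  in_trunc z x -> [\/ x = -oo, x = 0 | exists2 r, x = r%:E & (1 <= r <= z)%R].
Proof.
case/or3P => [/eqP->|/eqP->|]; [exact: Or31|exact: Or32|].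
case: x => [r||]; rewrite ?leye_eq ?andbF //.
by rewrite !lee_fin => rP; apply: Or33; exists r.
Qed.

Lemma in_trunc_mul a b : in_trunc z (mine (trunc_val a + trunc_val b) z%:E).
Proof.
have z0 : (0 <= z)%R by apply: le_trans (ltW z_gt1).
have [->|->|[r -> /andP[r1 rz]]] := in_truncP (trunc_valP a).
- by rewrite addNye minNye in_trunc_ninfty.
- rewrite add0e; suff -> : mine (trunc_val b) z%:E = b by apply: trunc_valP.
  apply/min_idPl.
  by have [->|->|[s -> /andP[]]] := in_truncP (trunc_valP b);
    rewrite ?leNye ?lee_fin.
have [->|->|[s -> /andP[s1 sz]]] := in_truncP (trunc_valP b).
- by rewrite addeNy minNye in_trunc_ninfty.
- by rewrite adde0 -EFin_min /in_trunc lee_fin (min_idPl rz) r1 lee_fin rz !orbT.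
rewrite -EFinD -EFin_min /in_trunc !lee_fin le_min ge_min lexx (ltW z_gt1).
by rewrite (le_trans r1) ?lerDl ?(le_trans ler01) ?orbT.
Qed.

Definition trunc_zero : T := TruncTrop z_gt1 in_trunc_ninfty.
Definition trunc_one : T := TruncTrop z_gt1 in_trunc0.
Definition trunc_add a b : T := TruncTrop z_gt1 (in_trunc_max a b).
Definition trunc_mul a b : T := TruncTrop z_gt1 (in_trunc_mul a b).

Lemma trunc_ge0_or (x : \bar R) : in_trunc z x -> x = -oo \/ 0 <= x <= z%:E.
Proof.
have z0 : (0 <= z)%R by apply: le_trans (ltW z_gt1).
move=> /in_truncP[->|->|[r -> /andP[r1 rz]]]; [by left|right|right].
- by rewrite lexx lee_fin.
- by rewrite !lee_fin rz (le_trans ler01).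
Qed.

Lemma trunc_addA : associative trunc_add.
Proof. by move=> a b c; apply/val_inj; rewrite /= maxA. Qed.

Lemma trunc_addC : commutative trunc_add.
Proof. by move=> a b; apply/val_inj; rewrite /= maxC. Qed.

Lemma trunc_add0 : left_id trunc_zero trunc_add.
Proof. by move=> a; apply/val_inj; rewrite /= maxNye. Qed.

Lemma trunc_mulC : commutative trunc_mul.
Proof. by move=> a b; apply/val_inj; rewrite /= addeC. Qed.

Lemma min_addl (x y : \bar R) : in_trunc z y ->
  mine (mine x z%:E + y) z%:E = mine (x + y) z%:E.
Proof.
case/trunc_ge0_or => [->|/andP[y0 _]]; first by rewrite !addeNy.
have [//|zx] := leP x z%:E.
by rewrite !min_r // ?leeDl // (le_trans (ltW zx)) ?leeDl.
Qed.

Lemma trunc_mulA : associative trunc_mul.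
Proof.
move=> a b c; apply/val_inj => /=.
rewrite (min_addl _ (trunc_valP c)) [trunc_val a + _]addeC.
by rewrite (min_addl _ (trunc_valP a)) [_ + trunc_val a]addeC addeA.
Qed.

Lemma trunc_mul1 : left_id trunc_one trunc_mul.
Proof.
move=> a; apply/val_inj; rewrite /= add0e; apply/min_idPl.
by case: (trunc_ge0_or (trunc_valP a)) => [->|/andP[]]; rewrite ?leNye.
Qed.

Lemma trunc_mulDl : left_distributive trunc_mul trunc_add.
Proof. by move=> a b c; apply/val_inj; rewrite /= adde_maxl min_maxl. Qed.

Lemma trunc_mul0 : left_zero trunc_zero trunc_mul.
Proof. by move=> a; apply/val_inj; rewrite /= addNye minNye. Qed.

Lemma trunc_one_neq0 : trunc_one != trunc_zero.
Proof. by rewrite -val_eqE. Qed.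

HB.instance Definition _ :=
  GRing.isNmodule.Build T trunc_addA trunc_addC trunc_add0.
HB.instance Definition _ := GRing.Nmodule_isComNzSemiRing.Build T
  trunc_mulA trunc_mulC trunc_mul1 trunc_mulDl trunc_mul0 trunc_one_neq0.

End TruncatedSemiring.

Lemma gt1_of_gt2 (R : realType) (z : R) : 2 < z -> 1 < z.
Proof. by apply: lt_trans; rewrite ltr1n. Qed.

(* Main.v *)
Require Import Defs.
From mathcomp Require Import all_boot all_order all_algebra all_fingroup.
From mathcomp Require Import reals.
From mathcomp Require Import constructive_ereal.
From mathcomp Require Import zify lra.

Import Order.TTheory GRing.Theory Num.Theory.
Local Open Scope ring_scope.

(** Call an element of the truncated semiring positive if it is neither of the
two neutral elements, that is, if it lies in [[1, z]].  A product of positive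
elements with at least [z] factors equals [z], so only boundedly many positive
factors carry quantitative information.

Size at least 3.  Given any number [K] of factors, let the [x]-th factor be the
identity matrix with two additional entries, [a_x] at [(0, 1)] and [b_x] at
[(1, 2)].  The entry [(0, 2)] of a product is then the maximum of [a_x b_y] over
the pairs such that [x] stands before [y] ([two_step_prod]).  Since [z > 2], a
step [d > 0] can be chosen so that [a_x = 1 + x d] and [b_y = 1 + (K - y) d] are
legitimate and [a_x b_y], which is [2 + (K + x - y) d] truncated at [z], is at
most [B = 2 + (K - 1) d < z] exactly when [x < y].  So the entry is at most [B] only
if the factors stand in increasing order: no other order gives the same
product.

Size at most 2.  Being -oo, 0 or positive is compatible with sums and products,
so matrices have finitely many patterns ([pattern]), and products of matrices
act on them.  By Ramsey's theorem for pairs of positions, a long enough word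
contains many consecutive blocks such that all products of successive blocks
have the same pattern [e] ([ramsey_increasing]).  Two adjacent blocks [A], [B] in the
middle can then be exchanged, [V A B W = V B A W], where [V] and [W] consist of
at least [z] blocks each ([swap_middle]).  Indeed both products have pattern
[e], so that only the entries [(i, j)] with [e i j] positive matter.  If
[e i i] or [e j j] is positive, staying at [i] in [V] or at [j] in [W] already
yields [z], and both entries equal [z].  Otherwise [i] and [j] are distinct, so
they are the only indices, all blocks have the same diagonal entries [alpha] at
[i] and [beta] at [j], both in [{-oo, 0}], and the entry of a product of blocks
is computed by [(X Y) i j = alpha Y_ij + X_ij beta], from which the symmetry in
the two middle blocks is visible.  A third index is precisely what would break
this formula. *)

(** * Ramsey's theorem for pairs of positions *)

Lemma pigeonhole_count (X : Type) (C : finType) (f : X -> C) (m : nat)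
    (L : seq X) :
  (#|C| * m < size L)%N -> exists a, (m < count (fun x => f x == a) L)%N.
Proof.
move=> ltL; apply/existsP; apply: contraTT ltL; rewrite negb_exists => /forallP le_m.
rewrite -leqNgt -sum1_size (partition_big f xpredT) //= -sum_nat_const.
by apply: leq_sum => a _; rewrite sum1_count leqNgt le_m.
Qed.

(** The greedy half of Ramsey's theorem: keep the first element and, among the
later ones, only a largest colour class as seen from it; then repeat.  The
colour is recorded next to the element, so that a second application of the
pigeonhole principle can select on it. *)
Lemma end_homogeneous_subseq (C : finType) (n : nat) : exists K : nat,
  forall (c : nat -> nat -> C) (L : seq nat), (K <= size L)%N ->
  exists l : seq (nat * C), [/\ size l = n, subseq (unzip1 l) L
    & pairwise (fun u v => c u.1 v.1 == u.2) l].
Proof.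
elim: n => [|n [K IHn]]; first by exists 0%N => c L _;
  exists [::]; split=> //; apply: sub0seq.
exists (#|C| * K).+2 => c [//|x L] /= ltL.
have [a lta] := @pigeonhole_count _ C (c x) K L ltL.
rewrite -size_filter in lta.
have [l [szl sub_l pw_l]] := IHn c _ (ltnW lta).
exists ((x, a) :: l); split; rewrite /= ?szl ?eqxx ?pw_l ?andbT //.
  exact: subseq_trans sub_l (filter_subseq _ _).
apply/allP => v vl; have /(mem_subseq sub_l) : v.1 \in unzip1 l by apply: map_f.
by rewrite mem_filter => /andP[].
Qed.

Lemma ramsey_increasing (C : finType) (m : nat) : exists K : nat,
  forall c : nat -> nat -> C, exists (e : C) (x : nat -> nat),
    forall i j, (i < j < m)%N -> (x i < x j < K)%N /\ c (x i) (x j) = e.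
Proof.
have [K homK] := end_homogeneous_subseq C (#|C| * m).+1.
exists K => c; have [|l [szl sub_l pw_l]] := homK c (iota 0 K).
  by rewrite size_iota.
have [|e lte] := @pigeonhole_count _ C snd m l; first by rewrite szl.
set l' := [seq u <- l | u.2 == e]; rewrite -size_filter -/l' in lte.
have sub_l' : subseq (unzip1 l') (iota 0 K).
  by apply: subseq_trans sub_l; apply: map_subseq; apply: filter_subseq.
have incr : pairwise ltn (unzip1 l').
  by apply: subseq_pairwise sub_l' _;
    rewrite -(sorted_pairwise ltn_trans) iota_ltn_sorted.
have homl' : pairwise (fun p q => c p q == e) (unzip1 l').
  rewrite pairwise_map.
  apply: (sub_in_pairwise (P := [pred u | u.2 == e]) _ _ (pairwise_filter _ pw_l)).
    by move=> u v /eqP <- _.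
  exact: filter_all.
exists e, (nth 0%N (unzip1 l')) => i j /andP[ltij ltjm].
have szj : (j < size (unzip1 l'))%N by rewrite size_map; apply: ltn_trans lte.
have szi := ltn_trans ltij szj.
split; last by apply/eqP; apply: (pairwiseP 0%N homl').
rewrite [X in X && _](pairwiseP 0%N incr) //=.
by have := mem_subseq sub_l' (mem_nth 0%N szj); rewrite mem_iota add0n.
Qed.

(** * Rearranging a product *)

Section Products.
Variable A : pzSemiRingType.

Lemma sgprodE (k : nat) (s : 'I_k.+1 -> mult_semigroup A) :
  sgprod s = \prod_(i < k.+1) (s i : A).
Proof.
rewrite /sgprod big_ord_recr /=.
elim: (index_enum _) => [|i r IHr]; first by rewrite !big_nil mul1r.
by rewrite !big_cons IHr; apply: mulrA.
Qed.

(** Rearrangements are easier to build as lists of positions than as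
permutations: a list that enumerates all positions in another order yields a
permutation other than the identity. *)
Lemma sgprod_rearranged (k : nat) (s : 'I_k.+2 -> mult_semigroup A) (l : seq nat) :
  perm_eq l (iota 0 k.+2) -> l != iota 0 k.+2 ->
  \prod_(i <- l) (s (inord i) : A) = \prod_(i <- iota 0 k.+2) (s (inord i) : A) ->
  exists2 sigma : 'S_k.+2, sigma <> 1%g & sgprod (s \o sigma) = sgprod s.
Proof.
move=> perm_l neq_l eq_prod.
have szl : size l = k.+2 by rewrite (perm_size perm_l) size_iota.
have ltl (i : 'I_k.+2) : (nth 0 l i < k.+2)%N.
  have : nth 0%N l i \in l by rewrite mem_nth ?szl.
  by rewrite (perm_mem perm_l) mem_iota.
pose f (i : 'I_k.+2) : 'I_k.+2 := inord (nth 0%N l i).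
have f_inj : injective f.
  move=> i j /(congr1 val); rewrite /= !inordK ?ltl // => /eqP.
  by rewrite nth_uniq ?szl ?(perm_uniq perm_l) ?iota_uniq // => /eqP/val_inj.
exists (perm f_inj).
  move=> sigma1; case/eqP: neq_l; apply: (@eq_from_nth _ 0%N).
    by rewrite szl size_iota.
  move=> i; rewrite szl => lti; rewrite nth_iota // add0n.
  have /(congr1 val) := permE f_inj (Ordinal lti).
  by rewrite sigma1 perm1 /= inordK // (ltl (Ordinal lti)).
rewrite !sgprodE; transitivity (\prod_(i <- l) (s (inord i) : A)).
  rewrite (big_nth 0%N) szl big_mkord.
  by apply: eq_bigr => i _; rewrite /= permE.
rewrite eq_prod -[iota _ _]/(index_iota 0 k.+2) big_mkord.
by apply: eq_bigr => i _; rewrite inord_val.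
Qed.

(** The form in which rearrangements occur below: only the context from [o] to
[w] is needed to see that the blocks [[p, q)] and [[q, r)] can be exchanged. *)
Lemma sgprod_swap_blocks (k : nat) (s : 'I_k.+2 -> mult_semigroup A)
    (o p q r w : nat) (F := fun i => s (inord i) : A) :
  (o <= p < q)%N -> (q < r <= w)%N -> (w <= k.+2)%N ->
  (\prod_(o <= i < p) F i) * (\prod_(p <= i < q) F i)
    * (\prod_(q <= i < r) F i) * (\prod_(r <= i < w) F i)
  = (\prod_(o <= i < p) F i) * (\prod_(q <= i < r) F i)
    * (\prod_(p <= i < q) F i) * (\prod_(r <= i < w) F i) ->
  exists2 sigma : 'S_k.+2, sigma <> 1%g & sgprod (s \o sigma) = sgprod s.
Proof.
move=> /andP[le_op lt_pq] /andP[lt_qr le_rw] le_wk eq_prod.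
pose I := index_iota; have I_cat a b c : (a <= b <= c)%N -> I a c = I a b ++ I b c.
  move=> /andP[ab bc]; rewrite /I /index_iota -{2}(subnKC ab) -iotaD; congr iota; lia.
have eq_iota : iota 0 k.+2 =
    I 0%N o ++ I o p ++ (I p q ++ I q r) ++ I r w ++ I w k.+2.
  rewrite -[LHS]/(I 0%N k.+2) (I_cat 0%N o); last by lia.
  congr (_ ++ _); rewrite (I_cat o p); last by lia.
  congr (_ ++ _); rewrite (I_cat p r k.+2); last by lia.
  by rewrite (I_cat p q r) ?(I_cat r w k.+2) //; lia.
pose l := I 0%N o ++ I o p ++ (I q r ++ I p q) ++ I r w ++ I w k.+2.
apply: (sgprod_rearranged _ _ l).
- by rewrite eq_iota /l !perm_cat2l perm_cat2r perm_catC.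
- apply/negP; rewrite eq_iota /l.
  rewrite (eqseq_cat _ _ (erefl (size (I 0%N o)))) eqxx /=.
  rewrite (eqseq_cat _ _ (erefl (size (I o p)))) eqxx /=.
  rewrite eqseq_cat ?size_cat 1?addnC // => /andP[/eqP + _].
  rewrite /I /index_iota -(@ltn_predK 0 (r - q)) ?subn_gt0 //.
  by rewrite -(@ltn_predK 0 (q - p)) ?subn_gt0 //= => -[eq_qp _]; lia.
- rewrite eq_iota /l !big_cat /= -/F !mulrA; congr (_ * _).
  by rewrite -!mulrA; congr (_ * _); rewrite !mulrA.
Qed.

End Products.

(** * Patterns and saturation in the truncated semiring *)

Section Trunc.
Set Implicit Arguments.
Unset Strict Implicit.
Variables (R : realType) (z : R) (z_gt1 : 1 < z).
Local Notation T := (trunc_trop z_gt1).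
Implicit Types a b c : T.

Lemma truncP a : [\/ a = 0, a = 1
  | exists2 r, trunc_val a = r%:E & [/\ a != 0, a != 1 & 1 <= r <= z]].
Proof.
have [a0|a1|[r ar r1z]] := in_truncP (trunc_valP a).
- by apply: Or31; apply/val_inj.
- by apply: Or32; apply/val_inj.
apply: Or33; exists r => //; split=> //; rewrite -val_eqE /= ar //.
by apply/eqP => -[r0]; move: r1z; rewrite r0 ler10.
Qed.

Lemma trunc_valD a b : trunc_val (a + b) = maxe (trunc_val a) (trunc_val b).
Proof. by []. Qed.

Lemma trunc_valM a b : trunc_val (a * b) = mine (trunc_val a + trunc_val b)%E z%:E.
Proof. by []. Qed.

Lemma trunc_val_fin a : a != 0 -> exists2 r, trunc_val a = r%:E & 0 <= r <= z.
Proof.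
have [->|->|[r ar [_ _ /andP[r1 rz]]] _] := truncP a; first by rewrite eqxx.
  by exists 0 => //; rewrite lexx /= (ltW (lt_trans ltr01 z_gt1)).
by exists r => //; rewrite rz andbT; lra.
Qed.

Lemma trunc_addr_eq0 a b : (a + b == 0) = (a == 0) && (b == 0).
Proof.
have [->|a0] := eqVneq a 0; first by rewrite add0r.
have [r ar _] := trunc_val_fin a0; apply/eqP => /(congr1 (@trunc_val _ _ _)).
by rewrite trunc_valD ar /= => /eqP; rewrite -leeNy_eq ge_max andbC leeNy_eq andbF.
Qed.

Lemma trunc_mulr_eq0 a b : (a * b == 0) = (a == 0) || (b == 0).
Proof.
have [->|a0] := eqVneq a 0; first by rewrite mul0r eqxx.
have [->|b0] := eqVneq b 0; first by rewrite mulr0 eqxx.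
have [r ar _] := trunc_val_fin a0; have [t bt _] := trunc_val_fin b0.
apply/eqP => /(congr1 (@trunc_val _ _ _)).
by rewrite trunc_valM ar bt -EFinD -EFin_min.
Qed.

Lemma trunc_addr_eq1 a b :
  (a + b == 1) = [|| (a == 1) && (b == 1), (a == 1) && (b == 0) | (a == 0) && (b == 1)].
Proof.
have [->|a0] := eqVneq a 0; first by rewrite add0r (eq_sym 0) oner_eq0.
have [->|b0] := eqVneq b 0.
  by rewrite addr0 (eq_sym 0) oner_eq0 /= andbF andbT orbF.
rewrite /= !andbF !orbF.
have [r ar /andP[r0 _]] := trunc_val_fin a0.
have [t bt /andP[t0 _]] := trunc_val_fin b0.
rewrite -!val_eqE /= ar bt -EFin_max !eqe !eq_le ge_max le_max r0 t0 /= !andbT.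
by [].
Qed.

Lemma trunc_mulr_eq1 a b : (a * b == 1) = (a == 1) && (b == 1).
Proof.
have [->|->|[r ar [a0 /negPf a1 /andP[r1 rz]]]] := truncP a.
- by rewrite mul0r.
- by rewrite mul1r eqxx.
rewrite a1; apply/eqP => ab1.
have b0 : b != 0 by apply: contra_eq_neq ab1 => ->; rewrite mulr0 eq_sym oner_neq0.
have [t bt /andP[t0 _]] := trunc_val_fin b0.
move/(congr1 (@trunc_val _ _ _)) : ab1; rewrite trunc_valM ar bt -EFinD -EFin_min => -[].
by rewrite /Num.min; case: ifP => _; lra.
Qed.

(** The class of [a] among -oo, 0 and [[1, z]], these being respectively the zero,
the one and the other elements of the semiring; [(false, false)] is the class
of the positive elements. *)
Definition tag a : bool * bool := (a == 0, a == 1).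

(** Classes are preserved by the operations because the four equality criteria
above only refer to equality tests of the arguments. *)
Lemma tagD a a' b b' : tag a = tag a' -> tag b = tag b' -> tag (a + b) = tag (a' + b').
Proof.
by move=> [a0 a1] [b0 b1]; rewrite /tag !trunc_addr_eq0 !trunc_addr_eq1 a0 a1 b0 b1.
Qed.

Lemma tagM a a' b b' : tag a = tag a' -> tag b = tag b' -> tag (a * b) = tag (a' * b').
Proof.
by move=> [a0 a1] [b0 b1]; rewrite /tag !trunc_mulr_eq0 !trunc_mulr_eq1 a0 a1 b0 b1.
Qed.

Lemma nonpositive_tag_inj a b : tag a = tag b -> tag a != (false, false) -> a = b.
Proof.
rewrite /tag; have [->|_] := eqVneq a 0; first by case=> /esym/eqP->.
by have [->|//] := eqVneq a 1; case=> _ /esym/eqP->.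
Qed.

Lemma positive_neq0 a : tag a = (false, false) -> a != 0.
Proof. by case=> ->. Qed.

Lemma nonpositive_tag a : tag a != (false, false) -> a = 0 \/ a = 1.
Proof.
rewrite /tag; have [->|_] := eqVneq a 0; first by left.
by have [->|//] := eqVneq a 1; right.
Qed.

(** Truncating the bound [k] at [z] makes the bounds add up in products, which
[at_leastM] states. *)
Definition at_least (k : nat) a := (mine (k%:R)%:E z%:E <= trunc_val a)%E.

Lemma at_leastD k a b : at_least k a -> at_least k (a + b).
Proof. by rewrite /at_least trunc_valD le_max => ->. Qed.

Lemma at_leastM k l a b : at_least k a -> at_least l b -> at_least (k + l) (a * b).
Proof.
rewrite /at_least trunc_valM -!EFin_min.
have [->|a0] := eqVneq a 0; first by rewrite leeNy_eq.
have [->|b0] := eqVneq b 0; first by rewrite leeNy_eq.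
have [r -> /andP[r0 _]] := trunc_val_fin a0.
have [t -> /andP[t0 _]] := trunc_val_fin b0.
rewrite -EFinD -EFin_min !lee_fin le_min !ge_min natrD.
rewrite lexx orbT andbT => /orP[kr|zr] /orP[lt|zt].
- by rewrite lerD.
- by apply/orP; right; rewrite (le_trans zt) // lerDr.
- by apply/orP; right; rewrite (le_trans zr) // lerDl.
- by apply/orP; right; rewrite (le_trans zt) // lerDr.
Qed.

Lemma at_least0 : at_least 0 1.
Proof. by rewrite /at_least ge_min lexx. Qed.

Lemma at_least1 a : tag a = (false, false) -> at_least 1 a.
Proof.
have [->|->|[r ar [_ _ /andP[r1 _]]] _] := truncP a; rewrite /tag ?eqxx //.
by rewrite /at_least ar ge_min lee_fin r1.
Qed.

Definition saturated a := trunc_val a = z%:E.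

Lemma saturated_inj a b : saturated a -> saturated b -> a = b.
Proof. by move=> az bz; apply/val_inj; rewrite /= az bz. Qed.

Lemma trunc_val_le a : (trunc_val a <= z%:E)%E.
Proof.
have [->|a0] := eqVneq a 0; first by rewrite leNye.
by have [r -> /andP[_ rz]] := trunc_val_fin a0; rewrite lee_fin.
Qed.

Lemma at_least_saturated k a : z <= k%:R -> at_least k a -> saturated a.
Proof.
move=> zk; rewrite /at_least min_r ?lee_fin // => za.
by apply/eqP; rewrite eq_le trunc_val_le.
Qed.

Lemma saturatedD a b : saturated a -> saturated (a + b).
Proof. by rewrite /saturated trunc_valD => ->; rewrite max_l ?trunc_val_le. Qed.

Lemma saturatedM a b : saturated a -> b != 0 -> saturated (a * b).
Proof.
move=> az b0; have [t bt /andP[t0 _]] := trunc_val_fin b0.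
by rewrite /saturated trunc_valM az bt -EFinD min_r // lee_fin lerDl.
Qed.

(** * Exchanging two blocks of matrices of size at most 2 *)

Section Matrices.
Variable n : nat.
Implicit Types (A B : 'M[T]_n) (e : 'M[bool * bool]_n).

Definition pattern A : 'M[bool * bool]_n := map_mx tag A.

Lemma mulmx_entry A B i j : (A * B) i j = \sum_k A i k * B k j.
Proof. exact: mxE. Qed.

Lemma patternM A A' B B' :
  pattern A = pattern A' -> pattern B = pattern B' -> pattern (A * B) = pattern (A' * B').
Proof.
move=> /matrixP eqA /matrixP eqB; apply/matrixP => i j; rewrite !mxE.
apply: (big_ind2 (fun a b => tag a = tag b)) => // [*|k _]; first exact: tagD.
by apply: tagM; [have := eqA i k|have := eqB k j]; rewrite !mxE.
Qed.

Lemma pattern_tag A e i j : pattern A = e -> tag (A i j) = e i j.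
Proof. by move<-; rewrite mxE. Qed.

Lemma at_least_diagM k l A B i :
  at_least k (A i i) -> at_least l (B i i) -> at_least (k + l) ((A * B) i i).
Proof.
by move=> Ak Bl; rewrite mulmx_entry (bigD1 i) //=; apply/at_leastD/at_leastM.
Qed.

Lemma saturated_mulmxl A B i j :
  saturated (A i i) -> B i j != 0 -> saturated ((A * B) i j).
Proof.
by move=> Az B0; rewrite mulmx_entry (bigD1 i) //=; apply/saturatedD/saturatedM.
Qed.

Lemma saturated_mulmxr A B i j :
  A i j != 0 -> saturated (B j j) -> saturated ((A * B) i j).
Proof.
move=> A0 Bz; rewrite mulmx_entry (bigD1 j) //=; apply/saturatedD.
by rewrite mulrC; apply/saturatedM.
Qed.

(** This is where the size matters: besides [i] and [j] there is no index
through which a path from [i] to [j] could pass. *)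
Lemma mulmx_entry2 A B i j : (n < 3)%N -> i != j ->
  (A * B) i j = A i i * B i j + A i j * B j j.
Proof.
move=> n3 neq_ij; rewrite mulmx_entry (bigD1 i) //= (bigD1 j) 1?eq_sym //=.
rewrite big1 ?addr0 // => k /andP[ki kj]; exfalso.
have : (#|[set i; j; k]| <= n)%N by rewrite -[X in (_ <= X)%N]card_ord max_card.
rewrite -setUA cardsU1 cards2 !inE (negPf neq_ij) (eq_sym i k) (negPf ki).
by rewrite (eq_sym j k) kj /=; case: n n3 {k ki kj i j neq_ij A B} => [|[|[|]]].
Qed.

(** The outer factors [V] and [W] serve to saturate every positive diagonal
entry; the pattern of [A * B] makes [e] idempotent, so that all the products
involved have pattern [e]. *)
Lemma swap_middle e V A B W : (n < 3)%N ->
  pattern V = e -> pattern A = e -> pattern B = e -> pattern W = e ->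
  pattern (A * B) = e ->
  (forall i, e i i = (false, false) -> saturated (V i i) /\ saturated (W i i)) ->
  V * A * B * W = V * B * A * W.
Proof.
move=> n3 Ve Ae Be We ABe sat.
have idem X Y : pattern X = e -> pattern Y = e -> pattern (X * Y) = e.
  by move=> Xe Ye; rewrite -ABe; apply: patternM; rewrite ?Xe ?Ye.
rewrite -!mulrA; apply/matrixP => i j.
have Le : pattern (V * (A * (B * W))) = e by rewrite !idem.
have Re : pattern (V * (B * (A * W))) = e by rewrite !idem.
have [eij|eij] := eqVneq (e i j) (false, false); last first.
  by apply: nonpositive_tag_inj; rewrite ?(pattern_tag i j Le) ?(pattern_tag i j Re).
(* Stay at [i] during [V], or at [j] during [W]. *)
have [eii|eii] := eqVneq (e i i) (false, false).
  have [Vz _] := sat i eii.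
  by apply: saturated_inj; apply: saturated_mulmxl => //;
    apply: positive_neq0; rewrite (@pattern_tag _ e) // !idem.
have [ejj|ejj] := eqVneq (e j j) (false, false).
  have [_ Wz] := sat j ejj; rewrite !mulrA.
  by apply: saturated_inj; apply: saturated_mulmxr => //;
    apply: positive_neq0; rewrite (@pattern_tag _ e) // !idem.
have neq_ij : i != j by apply/eqP => ij; move: eii; rewrite {2}ij eij eqxx.
(* Non-positive entries are determined by the pattern, hence shared by all
   products of blocks. *)
have exact X Y k : pattern X = e -> pattern Y = e ->
    e k k != (false, false) -> X k k = Y k k.
  by move=> Xe Ye ek; apply: nonpositive_tag_inj; rewrite ?(pattern_tag k k Xe)
    ?(pattern_tag k k Ye).
have step X Y : pattern X = e -> pattern Y = e ->
    (X * Y) i j = W i i * Y i j + X i j * W j j.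
  by move=> Xe Ye; rewrite mulmx_entry2 // (exact X W i) // (exact Y W j).
rewrite !step ?idem //.
have Wii : tag (W i i) != (false, false) by rewrite (pattern_tag i i We).
have [->|->] := nonpositive_tag Wii.
  by rewrite !mul0r !add0r.
by rewrite !mul1r; congr (_ + _); apply: addrAC.
Qed.
End Matrices.
End Trunc.

(** * Matrices of size at most 2 *)

Section Permutable.
Set Implicit Arguments.
Unset Strict Implicit.
Variables (R : realType) (z : R) (z_gt1 : 1 < z) (n : nat).
Local Notation M := ('M[trunc_trop z_gt1]_n).

(** Each of the [d] consecutive blocks contributes at least 1 to the path that
stays at [i]. *)
Lemma saturated_block (e : 'M[bool * bool]_n) (F : nat -> M) (x : nat -> nat)
    (m o d : nat) (i : 'I_n) :
  (forall i j, (i < j < m)%N ->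
     (x i < x j)%N /\ pattern (\prod_(x i <= k < x j) F k) = e) ->
  (o + d < m)%N -> z <= d%:R -> e i i = (false, false) ->
  saturated ((\prod_(x o <= k < x (o + d)%N) F k) i i).
Proof.
move=> xP odm zd eii; apply: (@at_least_saturated _ _ _ d) => //; move: odm.
elim: d {zd} => [|d IHd] odm.
  by rewrite addn0 big_geq // mxE eqxx; apply: at_least0.
have [lt_od col] := xP (o + d)%N (o + d.+1)%N ltac:(lia).
have le_od : (x o <= x (o + d)%N)%N.
  by case: d lt_od {IHd} odm col => [|d] _ odm _;
    rewrite ?addn0 // ltnW // (xP _ _ _).1 //; lia.
have IH := IHd ltac:(lia).
have last_block := at_least1 (etrans (pattern_tag i i col) eii).
by rewrite (big_cat_nat le_od (ltnW lt_od)) /=;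
  have := at_least_diagM IH last_block; rewrite addn1.
Qed.

Lemma strongly_permutable_small : (n < 3)%N -> strongly_permutable (mult_semigroup M).
Proof.
move=> n3; have [N zN] : exists N : nat, z <= N%:R.
  by exists (Num.bound z); apply/ltW/archi_boundP; rewrite ltW // (lt_trans ltr01).
(* [N] blocks on each side of the two middle ones need [N + N + 3] cutting
   points. *)
have [k ramsey] := ramsey_increasing 'M[bool * bool]_n (N + N).+3.
exists k => s; pose F i : M := s (inord i).
have [e [x xP]] := ramsey (fun p q => pattern (\prod_(p <= i < q) F i)).
have xlt i j : (i < j < (N + N).+3)%N -> (x i < x j)%N by move=> /xP[/andP[]].
have colP i j : (i < j < (N + N).+3)%N ->
    pattern (\prod_(x i <= k < x j) F k) = e by move=> /xP[].
have N0 : (0 < N)%N by rewrite -(ltr_nat R) (lt_le_trans _ zN) // (lt_trans ltr01).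
apply: (@sgprod_swap_blocks _ k s (x 0%N) (x N) (x N.+1) (x N.+2) (x (N.+2 + N)%N)).
- by apply/andP; split; [apply: ltnW|]; apply: xlt; lia.
- by apply/andP; split; [|apply: ltnW]; apply: xlt; lia.
- have [/andP[_ ltk] _] := xP N (N.+2 + N)%N ltac:(lia); lia.
rewrite -/F; apply: (swap_middle (e := e)) => //; try by apply: colP; lia.
- rewrite -big_cat_nat; first by apply: colP; lia.
  + by rewrite ltnW // xlt //; lia.
  + by rewrite ltnW // xlt //; lia.
- have blockP i j : (i < j < (N + N).+3)%N ->
     (x i < x j)%N /\ pattern (\prod_(x i <= k < x j) F k) = e.
    by move=> ij; split; [apply: xlt|apply: colP].
  move=> i eii; split.
    by apply: (saturated_block (o := 0%N) (d := N) blockP) => //; lia.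
  by apply: (saturated_block (o := N.+2) (d := N) blockP) => //; lia.
Qed.
End Permutable.

(** * Matrices of size at least 3 *)

Section Bidiagonal.
Set Implicit Arguments.
Unset Strict Implicit.
Variables (A : pzSemiRingType) (m : nat).
Let i0 : 'I_m.+3 := inord 0.
Let i1 : 'I_m.+3 := inord 1.
Let i2 : 'I_m.+3 := inord 2.

(** A weighted transition graph: a loop of weight [1] at every vertex and two more
edges, from 0 to 1 and from 1 to 2. *)
Definition two_step_mx (a b : A) : 'M[A]_m.+3 :=
  1 + (\matrix_(i, j) (if (i == i0) && (j == i1) then a
    else if (i == i1) && (j == i2) then b else 0)).

Lemma two_step_mul (a b : A) (P : 'M[A]_m.+3) j :
  let Q := two_step_mx a b * P in
  [/\ Q i0 j = P i0 j + a * P i1 j, Q i1 j = P i1 j + b * P i2 j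
    & Q i2 j = P i2 j].
Proof.
have i01 : (i0 == i1) = false by rewrite -val_eqE /= !inordK.
have i02 : (i0 == i2) = false by rewrite -val_eqE /= !inordK.
have i12 : (i1 == i2) = false by rewrite -val_eqE /= !inordK.
rewrite /= /two_step_mx mulrDl mul1r; split; rewrite mxE; [congr (_ + _)|congr (_ + _)|].
- rewrite mxE (bigD1 i1) //= !mxE !eqxx big1 ?addr0 // => k /negPf ki.
  by rewrite mxE ki andbF i01 mul0r.
- rewrite mxE (bigD1 i2) //= !mxE !eqxx (eq_sym i1) i01 big1 ?addr0 // => k /negPf ki.
  by rewrite mxE ki andbF (eq_sym i1) i01 mul0r.
- rewrite [X in _ + X]mxE big1 ?addr0 // => k _.
  by rewrite mxE (eq_sym i2) i02 (eq_sym i2) i12 mul0r.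
Qed.

(** Paths from 0 to 2 take the first edge at one factor and the second edge at a
later one; the recursion splits them according to whether the first edge is
taken at the first factor. *)
Lemma two_step_prod (I : Type) (a b : I -> A) (l : seq I)
    (P := fun l => \prod_(x <- l) two_step_mx (a x) (b x)) :
  [/\ P l i1 i2 = \sum_(y <- l) b y,
      P [::] i0 i2 = 0
    & forall x, P (x :: l) i0 i2 = P l i0 i2 + a x * \sum_(y <- l) b y].
Proof.
have i02 : (i0 == i2) = false by rewrite -val_eqE /= !inordK.
have i12 : (i1 == i2) = false by rewrite -val_eqE /= !inordK.
have [P12 P22] : P l i1 i2 = \sum_(y <- l) b y /\ P l i2 i2 = 1.
  elim: l => [|x l [IH1 IH2]]; first by rewrite /P !big_nil !mxE eqxx i12.
  have [_ eq1 eq2] := two_step_mul (a x) (b x) (P l) i2.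
  by rewrite /P big_cons -/(P l) eq1 eq2 IH1 IH2 mulr1 big_cons addrC.
split=> // [|x]; first by rewrite /P big_nil mxE i02.
have [eq0 _ _] := two_step_mul (a x) (b x) (P l) i2.
by rewrite /P big_cons -/(P l) eq0 P12.
Qed.
End Bidiagonal.

Section NotPermutable.
Set Implicit Arguments.
Unset Strict Implicit.
Variables (R : realType) (z : R) (z_gt1 : 1 < z).
Local Notation T := (trunc_trop z_gt1).

Definition weight (r : R) : T := insubd (trunc_one z_gt1) r%:E.

Lemma weight_val (r : R) : 1 <= r <= z -> trunc_val (weight r) = r%:E.
Proof. by move=> r1z; rewrite val_insubd /in_trunc !lee_fin r1z !orbT. Qed.

Lemma trunc_sum_le (I : Type) (l : seq I) (F : I -> T) (c : T) (B : R) :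
  (trunc_val (c * \sum_(y <- l) F y)%R <= B%:E)%E
  = all (fun y => trunc_val (c * F y)%R <= B%:E)%E l.
Proof.
rewrite mulr_sumr; elim: l => [|y l IHl]; first by rewrite big_nil leNye.
by rewrite big_cons trunc_valD ge_max IHl.
Qed.

(** An entry that is the maximum of [a x * b y] over the pairs [x] before [y]
bounds all these pairs, which is how [pairwise] is defined. *)
Lemma two_step_prod_le (m : nat) (I : Type) (a b : I -> T) (l : seq I) (B : R) :
  (trunc_val ((\prod_(x <- l) two_step_mx m (a x) (b x))%R (inord 0) (inord 2)) <= B%:E)%E
  = pairwise (fun x y => trunc_val (a x * b y)%R <= B%:E)%E l.
Proof.
elim: l => [|x l IHl].
  by have [_ -> _] := two_step_prod m a b [::]; rewrite leNye.
have [_ _ ->] := two_step_prod m a b l.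
by rewrite trunc_valD ge_max IHl trunc_sum_le andbC.
Qed.

(** The weights make [a x * b y] exceed [B] exactly when [y <= x].  So the entry
is at most [B] for the increasing order, and for no other order, since that one
contains an inversion. *)
Lemma not_strongly_permutable_large (m : nat) :
  2 < z -> ~ strongly_permutable (mult_semigroup 'M[T]_m.+3).
Proof.
move=> z2 [k perm_k].
pose K : R := k.+2%:R; have K0 : 0 < K by rewrite ltr0n.
pose d := (z - 2) / K; have d0 : 0 < d by rewrite divr_gt0 // subr_gt0.
have Kd : K * d = z - 2 by rewrite mulrC divfK // gt_eqF.
pose a (x : 'I_k.+2) := weight (1 + x%:R * d).
pose b (y : 'I_k.+2) := weight (1 + (K - y%:R) * d).
pose B := 2 + (K - 1) * d.
have ord_bound (x : 'I_k.+2) : 0 <= x%:R * d <= z - 2.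
  by rewrite -Kd ler_pM2r // ler_nat ltnW // mulr_ge0 // ltW.
have abE x y : (trunc_val (a x * b y)%R <= B%:E)%E = (x < y)%N.
  have /andP[x0 x1] := ord_bound x; have /andP[y0 y1] := ord_bound y.
  rewrite trunc_valM !weight_val ?mulrBl ?Kd; try by apply/andP; split; lra.
  rewrite -EFinD -EFin_min lee_fin ge_min.
  (* Truncation does not interfere: [B] is smaller than [z]. *)
  have -> : (z <= B) = false by apply/negbTE; rewrite -ltNge /B mulrBl Kd; lra.
  rewrite orbF.
  have -> : (1 + x%:R * d + (1 + (z - 2 - y%:R * d)) <= B)
      = (x%:R * d + 1 * d <= y%:R * d).
    by rewrite /B mulrBl Kd; apply/idP/idP; lra.
  by rewrite -mulrDl ler_pM2r // natr1 ler_nat.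
pose s x : mult_semigroup 'M[T]_m.+3 := two_step_mx m (a x) (b x).
have [sigma sigma_neq1 eq_prod] := perm_k s; case: sigma_neq1.
have sortedP (tau : 'S_k.+2) :
    (trunc_val ((sgprod (s \o tau) : 'M[T]_m.+3) (inord 0) (inord 2)) <= B%:E)%E
    = sorted ltn [seq val (tau i) | i <- index_enum 'I_k.+2].
  rewrite sgprodE (eq_bigr (fun i => two_step_mx m (a (tau i)) (b (tau i)))) //.
  rewrite (two_step_prod_le m (a \o tau) (b \o tau)) sorted_pairwise;
    last exact: ltn_trans.
  by rewrite pairwise_map; apply: eq_pairwise => x y; rewrite abE.
have sorted1 : sorted ltn [seq val ((1%g : 'S_k.+2) i) | i <- index_enum 'I_k.+2].
  under eq_map do rewrite perm1.
  by rewrite -[index_enum _]enumT val_enum_ord iota_ltn_sorted.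
have sorted_sigma : sorted ltn [seq val (sigma i) | i <- index_enum 'I_k.+2].
  rewrite -sortedP eq_prod -(_ : sgprod (s \o (1%g : 'S_k.+2)) = sgprod s) ?sortedP //.
  by rewrite !sgprodE; apply: eq_bigr => i _; rewrite /= perm1.
have eq_map : [seq val (sigma i) | i <- index_enum 'I_k.+2]
    = [seq val ((1%g : 'S_k.+2) i) | i <- index_enum 'I_k.+2].
  apply: (irr_sorted_eq ltn_trans ltnn sorted_sigma sorted1) => x.
  apply/mapP/mapP => -[i _ ->].
    by exists (sigma i); rewrite ?perm1 ?mem_index_enum.
  by exists (sigma^-1 i)%g; rewrite ?perm1 ?permKV ?mem_index_enum.
apply/permP => i; apply: val_inj; move/eq_in_map: eq_map; apply.
exact: mem_index_enum.
Qed.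
End NotPermutable.

Theorem theorem4p7 (R : realType) (z : R) (hz : 2 < z) (n : nat) (hn : (0 < n)%N) :
  strongly_permutable (mult_semigroup 'M[trunc_trop (gt1_of_gt2 hz)]_n)
  <-> (n < 3)%N.
Proof.
split; last exact: strongly_permutable_small.
case: n hn => [|[|[|m]]] // _ perm_n.
by case: (not_strongly_permutable_large hz perm_n).
Qed.
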